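(* Let $x_0$ be a real number such that for every $x>x_0$ the interval $[x-x^{0.525},x]$ contains a prime, and let $r$ be the index with $p_{r-1}\le x_0<p_r$. Then for every integer $n>p_r$ there is a prime number $p$ with $(n-1)^2<p^{1-\epsilon}<n^2$, where $\epsilon=0.05$.
   Context: $p_1=2,p_2=3,\dots$ denotes the sequence of primes in increasing order. A constant $x_0$ as in the claim exists (Baker–Harman–Pintz). *)

(* Defs.v *)
From mathcomp Require Export all_boot all_order all_algebra.
From mathcomp Require Export reals exp.
Set Implicit Arguments.
Unset Strict Implicit.
Unset Printing Implicit Defensive.
Export Order.TTheory GRing.Theory Num.Theory.

Lemma prime_above_ex (m : nat) : exists p : nat, (m < p)%N && prime p.
Proof. by have [p lt_mp p_pr] := prime_above m; exists p; rewrite lt_mp. Qed.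

Definition next_prime (m : nat) : nat := ex_minn (prime_above_ex m).

(* [nth_prime k] is p_k, 1-indexed: p_1 = 2, p_2 = 3, ...
   The value at [k = 0] is junk (it is 1). *)
Definition nth_prime (k : nat) : nat := iter k next_prime 1%N.

Lemma nth_prime1 : nth_prime 1 = 2%N.
Proof.
rewrite /nth_prime /= /next_prime; case: ex_minnP => p /andP[lt1p _] /(_ 2%N isT).
by move=> le_p2; apply/eqP; rewrite eqn_leq le_p2.
Qed.

Lemma nth_prime_prime (k : nat) : prime (nth_prime k.+1).
Proof. by rewrite /nth_prime /= /next_prime; case: ex_minnP => p /andP[]. Qed.

Lemma nth_prime_ltS (k : nat) : (nth_prime k < nth_prime k.+1)%N.
Proof.
rewrite /nth_prime /= [X in (_ < X)%N]/next_prime.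
by case: ex_minnP => p /andP[].
Qed.

Lemma nth_prime_surj (p : nat) : prime p -> exists k : nat, nth_prime k.+1 = p.
Proof.
move=> p_pr; have ub k : (k < nth_prime k)%N.
  by elim: k => // k IHk; apply: leq_ltn_trans IHk (nth_prime_ltS k).
have exk : exists k, (p <= nth_prime k)%N by exists p; exact: ltnW.
case: (ex_minnP exk) => -[|k] le_pk min_k.
  by case: p p_pr le_pk {exk min_k} => [|[]].
exists k; apply/eqP; rewrite eqn_leq le_pk andbT.
have lt_kp : (nth_prime k < p)%N.
  by rewrite ltnNge; apply/negP => /min_k; rewrite ltnn.
rewrite /nth_prime /= /next_prime; case: ex_minnP => q _; apply.
by rewrite lt_kp.
Qed.

(* Main.v *)
Require Import Defs.
From mathcomp Require Import ring lra.
Local Open Scope ring_scope.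

(* With a = 2 / (1 - eps) = 40 / 19 one has a * 0.525 = a - 1, so the prime gap
   hypothesis at x = n ^ a yields a prime p with
   n ^ (a - 1) * (n - 1) <= p <= n ^ a, and the left-hand side exceeds
   (n - 1) ^ a.  Equality p = n ^ a would mean p ^ 19 = n ^ 40, which no prime
   satisfies. *)

(** If [p ^ i = n ^ j], then [p] divides [n], so [1 < p <= n] and [n ^ j = p ^ i <= n ^ i], which
    forces [j <= i]. *)
Lemma prime_expn_neq (p n i j : nat) :
  prime p -> (i < j)%N -> (0 < i)%N -> (p ^ i)%N <> (n ^ j)%N.
Proof.
move=> p_pr lt_ij i_gt0 epn.
have p_gt1 := prime_gt1 p_pr.
have j_gt0 : (0 < j)%N := leq_ltn_trans (leq0n i) lt_ij.
have n_gt0 : (0 < n)%N.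
  case: n epn => // /eqP; rewrite exp0n // expn_eq0 => /andP[/eqP p0].
  by rewrite p0 in p_pr.
have : (p %| n ^ j)%N by rewrite -epn dvdn_exp.
rewrite Euclid_dvdX // => /andP[/(dvdn_leq n_gt0) le_pn _].
have : (n ^ j <= n ^ i)%N by rewrite -epn leq_exp2r.
by rewrite leq_exp2l ?(leq_trans p_gt1) // leqNgt lt_ij.
Qed.

(** The right-hand side factors as [(y - 1) * y ^ (a - 1)]; splitting one factor [y - 1] off the
    left leaves the monotonicity of [t ^ (a - 1)]. *)
Lemma ltr_powR_pred (R : realType) (y a : R) :
  1 < y -> 1 < a -> (y - 1) `^ a < y `^ a - y `^ (a - 1).
Proof.
move=> y_gt1 a_gt1.
have y_gt0 : 0 < y by lra.
have split_pow (z : R) : 0 <= z -> z `^ a = z * z `^ (a - 1).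
  by move=> z_ge0; rewrite mulr_powRB1 //; lra.
rewrite !split_pow ?subr_ge0 ?ltW //.
have lt_pow : (y - 1) `^ (a - 1) < y `^ (a - 1).
  by apply: gt0_ltr_powR; rewrite ?nnegrE; lra.
by rewrite -{2}[y `^ (a - 1)]mul1r -mulrBl ltr_pM2l // subr_gt0.
Qed.

Theorem theorem13 (R : realType) (x0 : R)
  (hx0 : forall x : R, x0 < x ->
     exists p : nat, prime p /\ x - x `^ (525 / 1000) <= p%:R <= x)
  (r : nat) (hr : (1 < r)%N)
  (hrx0 : (nth_prime (r - 1))%:R <= x0 < (nth_prime r)%:R)
  (n : int) (hn : (nth_prime r)%:Z < n) :
  let eps : R := 5 / 100 in
  exists p : nat,
    prime p /\ ((n - 1) ^+ 2)%:~R < p%:R `^ (1 - eps) < (n ^+ 2)%:~R.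
Proof.
move=> eps.
case: n hn => [N|//]; rewrite ltz_nat => lt_rN.
have y_gt1 : 1 < N%:R :> R.
  rewrite ltr1n; apply: ltn_trans lt_rN.
  (* Since [r] is positive, [nth_prime r] is a genuine prime and not the junk value at 0. *)
  by case: r hr {hrx0} => // k _; rewrite prime_gt1 ?nth_prime_prime.
have y_gt0 : 0 < N%:R :> R by lra.
rewrite !rmorphXn rmorphB /= -pmulrn.
have lt_x0N : x0 < N%:R.
  by case/andP: hrx0 => _ /lt_trans; apply; rewrite ltr_nat.
pose a : R := 40 / 19.
have a_eps : a * (1 - eps) = 2%:R by rewrite /a /eps; field.
have a_gap : a * (525 / 1000) = a - 1 by rewrite /a; field.
have [|p [p_pr /andP[p_ge p_le]]] := hx0 (N%:R `^ a).
  apply: (lt_le_trans lt_x0N); rewrite -[leLHS]powRr1 ?(ltW y_gt0) //.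
  apply: ler_powR; first exact: ltW.
  by rewrite /a; lra.
exists p; split=> //.
(* Both squares become powers with exponent [1 - eps], so it remains to show
   [(N - 1) ^ a < p < N ^ a]. *)
have pow_eps (z : R) : 0 <= z -> z ^+ 2 = (z `^ a) `^ (1 - eps).
  by move=> z_ge0; rewrite -powRrM a_eps powR_mulrn.
have eps_gt0 : 0 < 1 - eps by rewrite /eps; lra.
rewrite !pow_eps ?(ltW y_gt0) ?subr_ge0 ?(ltW y_gt1) //.
apply/andP; split; apply: gt0_ltr_powR; rewrite ?nnegrE ?powR_ge0 //.
  apply: lt_le_trans p_ge; rewrite -powRrM a_gap.
  by apply: ltr_powR_pred => //; rewrite /a; lra.
(* The gap hypothesis gives only [p <= N ^ a]; equality is excluded by taking 19th powers, which
   clears the denominator of [a]. *)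
rewrite lt_neqAle p_le andbT; apply/eqP => p_eq.
have [//|//|] := @prime_expn_neq p N 19 40 p_pr.
apply/eqP; rewrite -(eqr_nat R) !natrX p_eq -!powR_mulrn ?powR_ge0 ?(ltW y_gt0) //.
by rewrite -powRrM; apply/eqP; congr (_ `^ _); rewrite /a; field.
Qed.
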